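(* Let $p>1$ be real and $n$ an even positive integer. For every partition $\lambda$, $P^{p^2}_{n/2,p}(\lambda)=P^{\mathrm{Alt}}_{n,p}(\lambda)$.
   Context: For a partition $\lambda$: $|\lambda|=\sum\lambda_i$, $m_i(\lambda)$ is the number of parts equal to $i$, $\lambda_i'$ is the $i$-th column length of its diagram, $r=r(\lambda)=\lambda_1'$ its number of parts, and $n(\lambda)=\sum_i\binom{\lambda_i'}{2}$. For real $q>1$, $0<u<q$ and a positive integer $d$, define \[ P^{q}_{d,u}(\lambda)=\frac{u^{|\lambda|}}{q^{\sum_i(\lambda_i')^2}\prod_i\prod_{j=1}^{m_i(\lambda)}(1-q^{-j})}\prod_{i=1}^d(1-u/q^i)\prod_{i=d-r+1}^d(1-1/q^i) \] if $r\le d$, and $P^q_{d,u}(\lambda)=0$ otherwise. Define \[ P^{\mathrm{Alt}}_{n,p}(\lambda)=\frac{\prod_{i=n-2r+1}^n(1-1/p^i)\prod_{i=1}^{n/2-r}(1-1/p^{2i-1})}{p^{|\lambda|+4n(\lambda)}\prod_i\prod_{j=1}^{m_i(\lambda)}(1-1/p^{2j})} \] if $r\le n/2$, and $P^{\mathrm{Alt}}_{n,p}(\lambda)=0$ otherwise. *)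

(* Defs.v *)
From HB Require Import structures.
From mathcomp Require Import all_boot all_order all_algebra.
From mathcomp Require Import reals.
Set Implicit Arguments.
Unset Strict Implicit.
Unset Printing Implicit Defensive.
Import Order.TTheory GRing.Theory Num.Theory.
Local Open Scope ring_scope.

Record int_partition := IntPartition {
  parts : seq nat;
  partsP : sorted geq parts && (0%N \notin parts)
}.

Definition part_weight (la : int_partition) : nat := sumn (parts la).

Definition part_mult (la : int_partition) (i : nat) : nat :=
  count_mem i (parts la).

(* Column i of the diagram (i >= 1) has one box for each part that is >= i. *)
Definition part_col (la : int_partition) (i : nat) : nat :=
  count (fun k => i <= k)%N (parts la).

Definition part_rank (la : int_partition) : nat := part_col la 1.

(* Sums and products over all i >= 1 are cut off at the largest part: beyond
   it, both part_col la i and part_mult la i are zero. *)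
Definition part_max (la : int_partition) : nat := head 0%N (parts la).

Definition part_n (la : int_partition) : nat :=
  (\sum_(1 <= i < (part_max la).+1) 'C(part_col la i, 2))%N.

Definition part_sqcol (la : int_partition) : nat :=
  (\sum_(1 <= i < (part_max la).+1) part_col la i ^ 2)%N.

(* Meant for 1 < q, 0 < u < q and 0 < d.  In the branch r <= d the truncated
   subtraction d - r is exact. *)
Definition Pdu (R : realType) (q : R) (d : nat) (u : R) (la : int_partition) : R :=
  let r := part_rank la in
  if (r <= d)%N then
    u ^+ part_weight la
      / (q ^+ part_sqcol la
         * \prod_(1 <= i < (part_max la).+1)
             \prod_(1 <= j < (part_mult la i).+1) (1 - 1 / q ^+ j))
    * \prod_(1 <= i < d.+1) (1 - u / q ^+ i)
    * \prod_((d - r).+1 <= i < d.+1) (1 - 1 / q ^+ i)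
  else 0.

(* Meant for 1 < p and n even and positive, so that n./2 is n / 2.  In the
   branch r <= n / 2 the truncated subtractions are exact. *)
Definition PAlt (R : realType) (n : nat) (p : R) (la : int_partition) : R :=
  let r := part_rank la in
  if (r <= n./2)%N then
    (\prod_((n - 2 * r).+1 <= i < n.+1) (1 - 1 / p ^+ i)
     * \prod_(1 <= i < (n./2 - r).+1) (1 - 1 / p ^+ (2 * i - 1)))
    / (p ^+ (part_weight la + 4 * part_n la)
       * \prod_(1 <= i < (part_max la).+1)
           \prod_(1 <= j < (part_mult la i).+1) (1 - 1 / p ^+ (2 * j)))
  else 0.

(* Main.v *)
(** Write [d = n/2].  Since the column lengths sum to [|la|], one has
    [\sum_i (la'_i)^2 = |la| + 2 n(la)], so the powers of [p] agree.  The factor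
    [\prod_(n-2r < i <= n) (1 - p^-i)] splits into its even indices, which give
    [\prod_(d-r < i <= d) (1 - p^(-2i))], and its odd indices, which complete
    [\prod_(1 <= i <= d-r) (1 - p^(1-2i))] to [\prod_(1 <= i <= d) (1 - p/p^(2i))]. *)
Require Import Defs.
From HB Require Import structures.
From mathcomp Require Import all_boot all_order all_algebra.
From mathcomp Require Import reals zify.
Import Order.TTheory GRing.Theory Num.Theory.
Local Open Scope ring_scope.

(** Induction on [s]: a new part [k <= m] adds one box to each of the columns 1 to [k] and none to
    later ones. *)
Lemma sum_count_geq (m : nat) (s : seq nat) :
  all (fun k => k <= m)%N s ->
  (\sum_(1 <= i < m.+1) count (fun k => i <= k) s = sumn s)%N.
Proof.
elim: s => [_|k s IHs /= /andP[le_km /IHs <-]]; first by rewrite big1.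
rewrite big_split /=; congr (_ + _)%N.
rewrite (@big_cat_nat _ _ _ k.+1) //= (eq_big_nat _ _ (F2 := fun=> 1%N)).
  rewrite sum_nat_const_nat big_nat_cond big1 ?addn0 ?muln1 ?subn1 //.
  by move=> i /andP[/andP[lt_ki _] _]; rewrite leqNgt lt_ki.
by move=> i /andP[_]; rewrite ltnS => ->.
Qed.

Lemma parts_le_max (la : int_partition) :
  all (fun k => k <= part_max la)%N (parts la).
Proof.
rewrite /part_max; case: la => [[|k s]] //= /andP[path_s _].
rewrite leqnn /=; apply: (order_path_min _ path_s).
by move=> y x z /= le_yx le_zy; apply: leq_trans le_zy le_yx.
Qed.

(** Column by column this is [c^2 = c + 2 * 'C(c, 2)]. *)
Lemma part_sqcolE (la : int_partition) :
  part_sqcol la = (part_weight la + 2 * part_n la)%N.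
Proof.
rewrite /part_weight -(sum_count_geq _ _ (parts_le_max la)) /part_n big_distrr.
rewrite -big_split; apply: eq_bigr => i _ /=.
rewrite -/(part_col la i); set c := part_col la i.
have := bin_ffact c 2; rewrite ffactnS ffactn1 (_ : 2`! = 2)%N //.
by case: c => [|c] /= Hc; nia.
Qed.

(** Induction on [b - a]: raising [b] by one adds one odd and one even index on the left. *)
Lemma prod_nat_double (R : comPzSemiRingType) (F : nat -> R) (a b : nat) :
  (a <= b)%N ->
  \prod_((2 * a).+1 <= i < (2 * b).+1) F i =
  \prod_(a.+1 <= i < b.+1) F (2 * i - 1)%N * \prod_(a.+1 <= i < b.+1) F (2 * i)%N.
Proof.
move=> /subnKC <-; elim: (b - a)%N => [|k IHk].
  by rewrite addn0 !big_geq // mulr1.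
have -> : (2 * (a + k.+1) = (2 * (a + k)).+2)%N by lia.
do 2 (rewrite big_nat_recr /=; last by lia).
rewrite IHk addnS !(@big_nat_recr _ _ _ (a + k).+1) /=; try by lia.
have -> : (2 * (a + k).+1 - 1 = (2 * (a + k)).+1)%N by lia.
have -> : (2 * (a + k).+1 = (2 * (a + k)).+2)%N by lia.
by rewrite mulrACA mulrA.
Qed.

Theorem theorem3p2 (R : realType) (p : R) (n : nat)
    (hp : 1 < p) (hn : (0 < n)%N) (hne : ~~ odd n) (la : int_partition) :
  Pdu (p ^+ 2) n./2 p la = PAlt n p la.
Proof.
have p_neq0 : p != 0 by rewrite gt_eqF // (lt_trans ltr01).
rewrite /Pdu /PAlt; case: ifP => // le_rd.
set d := n./2 in le_rd *; set r := part_rank la in le_rd *.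
(* Evenness of [n] turns [n - 2r] into [2(d - r)], the form that [prod_nat_double] takes. *)
have -> : n = (2 * d)%N by rewrite /d; lia.
rewrite -mulnBr prod_nat_double ?leq_subr // part_sqcolE.
under eq_bigr do under eq_bigr do rewrite -exprM.
(* The bound [0 < i] is kept because it makes the subtraction in [2 * i - 1] exact. *)
under [X in _ * X * _]eq_big_nat => i /andP[i_gt0 _].
  rewrite (_ : p / _ = 1 / p ^+ (2 * i - 1)); last first.
    rewrite -exprM -[in LHS](@subnK 1 (2 * i)) ?muln_gt0 // exprD expr1 invfM mul1r.
    by rewrite mulrCA mulfV // mulr1.
  over.
under [X in _ * X = _]eq_bigr do rewrite -exprM.
(* Cutting at [d - r] separates the odd factors explicit in [PAlt] from those coming out of its
   first product. *)
rewrite (@big_cat_nat _ _ _ (d - r).+1 1 d.+1) ?ltnS ?leq_subr //=.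
set M := \prod_(1 <= i < (part_max la).+1) _.
(* The numerator cancels one of the two copies of [|la|] in the exponent [2|la| + 4n(la)]. *)
have -> : p ^+ part_weight la / ((p ^+ 2) ^+ (part_weight la + 2 * part_n la) * M)
   = (p ^+ (part_weight la + 4 * part_n la) * M)^-1.
  rewrite -exprM (_ : (2 * _ = part_weight la +
    (part_weight la + 4 * part_n la))%N); last by lia.
  by rewrite exprD -mulrA [(_ * (_ * M))^-1]invfM mulVKf // expf_neq0.
rewrite [RHS]mulrC -!mulrA; congr (_ * _).
by rewrite [LHS]mulrC -mulrA.
Qed.
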